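(* Let $K$ be an infinite field and let $R = K[x_1,\ldots,x_n]$ be the polynomial ring in $n$ variables. For every $d\ge 2$ and every $j\in\{0,\ldots,d-1\}$, the $j$-th Veronese module $M_j^{(d)}=\bigoplus_{i\ge 0}R_{di+j}$ is a homogeneous module with straightening laws (MSL) on the poset $H_n(j)$ over the ASL $R^{(d)}$ (with its ASL structure on $H_n(d)$ given by the generators $f_{\alpha_1\ldots\alpha_d}$), with the following structure. The elements of $H_n(j)$ are identified with the generators $g_{i_1\ldots i_j}=\ell_{i_1,1}\cdots\ell_{i_j,j}$, $(i_1,\ldots,i_j)\in H_n(j)$, ordered component-wise, and the poset ideals are $$\mathcal I(g_{i_1\ldots i_j})=\{f_{\alpha_1\ldots\alpha_d} : (\alpha_1,\ldots,\alpha_d)\in H_n(d),\ (\alpha_1,\ldots,\alpha_j,\ldots,\alpha_d)\not\ge(i_1,\ldots,i_j,1,\ldots,1)\}.$$ (For $j=0$ the poset is the one-element poset $\{1\}\subset R^{(d)}=M_0^{(d)}$ and $\mathcal I(1)=\emptyset$.)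
   Context: All posets are finite. A poset ideal of a poset $P$ is a subset $I$ such that $\alpha\in I$, $\beta\in P$, $\beta\le\alpha$ imply $\beta\in I$. **ASL.** Let $A$ be a $K$-algebra and $P\subset A$ a finite poset. A product $\alpha_1\cdots\alpha_t$ with $\alpha_i\in P$ is a monomial; it is standard if $\alpha_1\le\cdots\le\alpha_t$. $A$ is a (graded) algebra with straightening laws (ASL) on $P$ over $K$ if: (ASL 0) $A=\bigoplus_{i\ge0}A_i$ is a graded $K$-algebra with $A_0=K$, the elements of $P$ are homogeneous of positive degree and generate $A$ as a $K$-algebra; (ASL 1) the standard monomials form a $K$-basis of $A$; (ASL 2) if $\alpha,\beta\in P$ are incomparable and $\alpha\beta=\sum_i r_i\gamma_{i1}\cdots\gamma_{it_i}$, with $0\ne r_i\in K$ and $\gamma_{i1}\le\cdots\le\gamma_{it_i}$, is the unique expression as a linear combination of standard monomials (possibly $0$), then $\gamma_{i1}<\alpha$ and $\gamma_{i1}<\beta$ for every $i$. $A$ is a homogeneous ASL if $P\subset A_1$. **MSL.** Let $A$ be an ASL on $P$ over $K$. An $A$-module $M$ is a module with straightening laws (MSL) on a finite poset $Q\subset M$ if: (MSL 1) for every $x\in Q$ there is a poset ideal $\mathcal I(x)\subset P$ such that the elements $\alpha_1\cdots\alpha_i x$ with $x\in Q$, $i\ge0$, $\alpha_1\le\cdots\le\alpha_i$ in $P$ and $\alpha_1\notin\mathcal I(x)$ (the standard elements) form a $K$-basis of $M$; (MSL 2) for every $x\in Q$ and $\alpha\in\mathcal I(x)$ one has $\alpha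 x\in\sum_{y<x}Ay$. An MSL on $Q$ over a homogeneous ASL $A$ is homogeneous if it is a graded $A$-module in which $Q$ consists of elements of degree $0$. **Veronese objects.** $R^{(d)}=\bigoplus_{i\ge0}R_{di}$, graded by $(R^{(d)})_i=R_{di}$; $M_j^{(d)}=\bigoplus_{i\ge0}R_{di+j}$ is an $R^{(d)}$-module graded by $(M_j^{(d)})_i=R_{di+j}$. **The posets.** For $e\ge1$, $H_n(e)=\{(\alpha_1,\ldots,\alpha_e)\in\{1,\ldots,n\}^e : \sum_{i=1}^e\alpha_i\le n+e-1\}$, ordered component-wise. **The linear forms and generators.** For $i=1,\ldots,n$ and $k=1,\ldots,d$, let $\ell_{i,k}\in R_1$ be fixed generic linear forms, such that for all $j_1,\ldots,j_n\in\{1,\ldots,d\}$ the forms $\ell_{1,j_1},\ldots,\ell_{n,j_n}$ are linearly independent, and such that the following known theorem of Conca applies to them (it holds for a generic choice, which exists since $K$ is infinite): the products $f_{\alpha_1\ldots\alpha_d}=\ell_{\alpha_1,1}\cdots\ell_{\alpha_d,d}$, $(\alpha_1,\ldots,\alpha_d)\in H_n(d)$, ordered component-wise by their indices, make $R^{(d)}$ a homogeneous ASL on $H_n(d)$ over $K$. The same forms are used to define $g_{i_1\ldots i_j}$. *)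

(* Defs.v *)
From HB Require Import structures.
From mathcomp Require Import all_boot all_order all_algebra.
From mathcomp Require Export mpoly.

Set Implicit Arguments.
Unset Strict Implicit.
Unset Printing Implicit Defensive.

Import Order.TTheory GRing.Theory.
Local Open Scope ring_scope.

Section Generic.
Variable K : fieldType.

(* [V] is the internal direct sum of the [G i], [i >= 0]. *)
Definition direct_sum (V : zmodType) (G : nat -> V -> Prop) : Prop :=
  [/\ forall i, G i 0 /\ (forall u v, G i u -> G i v -> G i (u - v)),
      forall v, exists N (c : nat -> V),
        (forall i, G i (c i)) /\ v = \sum_(i < N) c i
    & forall N (c : nat -> V), (forall i, G i (c i)) ->
        \sum_(i < N) c i = 0 -> forall i, (i < N)%N -> c i = 0].

(* Graded K-algebra with degree-0 part equal to K.  Stability of each [G i]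
   under scalars follows from [grading_mul] and [grading_K]. *)
Record graded_algebra (A : comAlgType K) (G : nat -> A -> Prop) : Prop := {
  grading_sum : direct_sum G;
  grading_mul : forall i j a b, G i a -> G j b -> G (i + j)%N (a * b);
  grading_K : forall a, G 0%N a <-> exists k : K, a = k%:A
}.

Record graded_module (A : comAlgType K) (G : nat -> A -> Prop)
    (M : lmodType A) (GM : nat -> M -> Prop) : Prop := {
  gmod_sum : direct_sum GM;
  gmod_act : forall i j a m, G i a -> GM j m -> GM (i + j)%N (a *: m)
}.

(* The family [b], restricted to the indices satisfying [S], is a K-basis of
   the A-module [M]; K acts on [M] through K -> A. *)
Definition is_Kbasis (A : comAlgType K) (M : lmodType A) (I : eqType)
    (S : pred I) (b : I -> M) : Prop :=
  (forall (s : seq I) (c : I -> K), uniq s -> all S s ->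
     \sum_(i <- s) (c i)%:A *: b i = 0 -> forall i, i \in s -> c i = 0) /\
  (forall m : M, exists (s : seq I) (c : I -> K),
     [/\ uniq s, all S s & m = \sum_(i <- s) (c i)%:A *: b i]).

Definition generates (A : comAlgType K) (T : Type) (x : T -> A) : Prop :=
  forall S : A -> Prop,
    S 1 -> (forall (k : K) a b, S a -> S b -> S (k *: a + b)) ->
    (forall a b, S a -> S b -> S (a * b)) -> (forall t, S (x t)) ->
    forall a, S a.

(* A finite poset contained in [A] is an abstract finite poset [P] together
   with an injection [x : P -> A]. *)
Section ASL.
Variables (A : comAlgType K) (GA : nat -> A -> Prop).
Variables (dP : Order.disp_t) (P : finPOrderType dP) (x : P -> A).

Definition monomial (s : seq P) : A := \prod_(p <- s) x p.

Definition standard (s : seq P) : bool := sorted <=%O s.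

Record ASL : Prop := {
  ASL_inj : injective x;
  ASL0_graded : graded_algebra GA;
  ASL0_pos : forall p, exists2 i, (0 < i)%N & GA i (x p);
  ASL0_gen : generates x;
  ASL1 : @is_Kbasis A A^o _ standard monomial;
  ASL2 : forall a b : P, (a >< b)%O ->
    forall (s : seq (seq P)) (r : seq P -> K),
      uniq s -> all standard s -> {in s, forall w, r w != 0} ->
      x a * x b = \sum_(w <- s) r w *: monomial w ->
      {in s, forall w, exists p w', [/\ w = p :: w', (p < a)%O & (p < b)%O]}
}.

Record homogeneous_ASL : Prop := {
  hASL_ASL : ASL;
  hASL_deg1 : forall p, GA 1%N (x p)
}.

Definition poset_ideal (I : {set P}) : Prop :=
  forall a b : P, a \in I -> (b <= a)%O -> b \in I.

Variables (M : lmodType A) (GM : nat -> M -> Prop).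
Variables (dQ : Order.disp_t) (Q : finPOrderType dQ) (y : Q -> M).
Variable I : Q -> {set P}.

(* The pair [(q, s)] stands for the element [monomial s *: y q]. *)
Definition standard_elt (e : Q * seq P) : bool :=
  standard e.2 && (if e.2 is p :: _ then p \notin I e.1 else true).

Record MSL : Prop := {
  MSL_base : ASL;
  MSL_inj : injective y;
  MSL1_ideal : forall q, poset_ideal (I q);
  MSL1_basis : is_Kbasis standard_elt
    (fun e : Q * seq P => monomial e.2 *: y e.1);
  MSL2 : forall q p, p \in I q ->
    exists c : Q -> A, x p *: y q = \sum_(q' : Q | (q' < q)%O) c q' *: y q'
}.

Record homogeneous_MSL : Prop := {
  hMSL_base : homogeneous_ASL;
  hMSL_MSL : MSL;
  hMSL_graded : graded_module GA GM;
  hMSL_deg0 : forall q, GM 0%N (y q)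
}.

End ASL.
End Generic.

(* 'I_n is 0-based: the entry [i : 'I_n] stands for i + 1 in {1,...,n}.
   For e = 0 the truncated subtraction makes H_n(0) the one-element poset,
   for every n. *)
Record Hposet (n e : nat) := HPoset {
  Hval :> e.-tupleprod 'I_n;
  _ : (\sum_(i <- Hval : seq 'I_n) (i : nat).+1 <= n + e - 1)%N
}.

HB.instance Definition _ n e := [isSub for @Hval n e].
HB.instance Definition _ n e := [Finite of Hposet n e by <:].
Fact Hposet_display : Order.disp_t. Proof. by []. Qed.
HB.instance Definition _ n e :=
  [SubChoice_isSubPOrder of Hposet n e by <: with Hposet_display].

Definition Hnth n e (t : Hposet n e) (k : 'I_e) : 'I_n :=
  tnth (Hval t : e.-tuple 'I_n) k.

(* The k-th entry (k = 0, 1, ...) of the 1-based index, continued by 1. *)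
Definition Hentry n e (t : Hposet n e) (k : nat) : nat :=
  (nth 0 [seq val i | i <- (Hval t : seq 'I_n)] k).+1.

Section Veronese.
Variables (K : fieldType) (n d : nat).

(* Membership in \bigoplus_{i >= 0} R_{d i + j}. *)
Definition veronese_pred (j : nat) : {pred {mpoly K[n]}} :=
  fun p => all (fun m => (j <= mdeg m)%N && (d %| mdeg m - j)%N) (msupp p).

Lemma veronese_pred_submod j : submod_closed (veronese_pred j).
Proof.
split=> [|c p q]; first by rewrite unfold_in msupp0.
move=> /allP hp /allP hq; apply/allP => m /msuppD_le.
by rewrite mem_cat => /orP [/msuppZ_le/hp|/hq].
Qed.

HB.instance Definition _ j := GRing.isSubmodClosed.Build K {mpoly K[n]}
  (veronese_pred j) (veronese_pred_submod j).

Lemma veronese_predM j p q :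
  p \in veronese_pred 0 -> q \in veronese_pred j -> p * q \in veronese_pred j.
Proof.
move=> /allP hp /allP hq; apply/allP => m /msuppM_le /allpairsP [[m1 m2]] /=.
case=> /hp /= h1 /hq /andP [h2 h3] ->; rewrite subn0 in h1.
by rewrite mdegD (leq_trans h2 (leq_addl _ _)) -addnBA // dvdn_add.
Qed.

Definition veralg_pred : {pred {mpoly K[n]}} := veronese_pred 0.

Lemma veralg_pred_subalg : subalg_closed veralg_pred.
Proof.
split.
- by apply/allP=> m; rewrite msupp1 inE => /eqP ->; rewrite mdeg0 dvdn0.
- by case: (veronese_pred_submod 0).
- by move=> p q hp hq; apply: (@veronese_predM 0).
Qed.

HB.instance Definition _ := GRing.isSubalgClosed.Build K {mpoly K[n]}
  veralg_pred veralg_pred_subalg.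

Record veralg := VerAlg {
  veralg_val :> {mpoly K[n]};
  _ : veralg_val \in veralg_pred
}.

HB.instance Definition _ := [isSub for veralg_val].
HB.instance Definition _ := [Choice of veralg by <:].
HB.instance Definition _ := [SubChoice_isSubAlgebra of veralg by <:].
HB.instance Definition _ := [SubNzRing_isSubComNzRing of veralg by <:].

Record vermod (j : nat) := VerMod {
  vermod_val :> {mpoly K[n]};
  _ : vermod_val \in veronese_pred j
}.

HB.instance Definition _ j := [isSub for @vermod_val j].
HB.instance Definition _ j := [Choice of vermod j by <:].
HB.instance Definition _ j := [SubChoice_isSubZmodule of vermod j by <:].

Section Action.
Variable j : nat.

Fact veract_subproof (a : veralg) (m : vermod j) :
  val a * val m \in veronese_pred j.
Proof. exact: veronese_predM (valP a) (valP m). Qed.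

(* R^(d) acts on M_j^(d) by multiplication in R. *)
Definition veract (a : veralg) (m : vermod j) : vermod j :=
  VerMod (veract_subproof a m).

Fact veractA a b m : veract a (veract b m) = veract (a * b) m.
Proof. by apply: val_inj; rewrite /= mulrA. Qed.

Fact veract1 : left_id 1 veract.
Proof. by move=> m; apply: val_inj; rewrite /= mul1r. Qed.

Fact veractDr : right_distributive veract +%R.
Proof. by move=> a u v; apply: val_inj; rewrite /= mulrDr. Qed.

Fact veractDl m : {morph veract^~ m : a b / a + b}.
Proof. by move=> a b; apply: val_inj; rewrite /= mulrDl. Qed.

HB.instance Definition _ := GRing.Zmodule_isLmodule.Build veralg (vermod j)
  veractA veract1 veractDr veractDl.

Definition vermod_grade (i : nat) (m : vermod j) : Prop :=
  val m \is (d * i + j)%N.-homog.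

End Action.

Definition veralg_grade (i : nat) (a : veralg) : Prop :=
  val a \is (d * i)%N.-homog.

Section Generators.
(* [dhomog n K 1] is the space R_1; [ell i k] is 0-based in both indices. *)
Variable ell : 'I_n -> 'I_d -> dhomog n K 1.

(* For e <= d, the product ell_{t_1,1} ... ell_{t_e,e}: f for e = d, g for e = j. *)
Definition ellprod e (he : (e <= d)%N) (t : Hposet n e) : {mpoly K[n]} :=
  \prod_(k < e) (ell (Hnth t k) (widen_ord he k) : {mpoly K[n]}).

Lemma ellprod_homog e (he : (e <= d)%N) t : ellprod he t \is e.-homog.
Proof.
rewrite -{2}[e]card_ord -sum1_card /ellprod.
elim/big_rec2: _ => [|k m p _ hp]; first exact: dhomog1.
by apply: dhomogM => //; apply: dhomog_is_dhomog.
Qed.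

Fact gen_f_subproof (t : Hposet n d) :
  ellprod (leqnn d) t \in veralg_pred.
Proof.
apply/allP => m /(dhomog_mf (ellprod_homog (leqnn d) t)) /= ->.
by rewrite subn0 dvdnn.
Qed.

Definition gen_f (t : Hposet n d) : veralg := VerAlg (gen_f_subproof t).

Fact gen_g_subproof (j : 'I_d) (t : Hposet n j) :
  ellprod (ltnW (ltn_ord j)) t \in veronese_pred j.
Proof.
apply/allP => m /(dhomog_mf (ellprod_homog (ltnW (ltn_ord j)) t)) /= ->.
by rewrite leqnn subnn dvdn0.
Qed.

Definition gen_g (j : 'I_d) (t : Hposet n j) : vermod j :=
  VerMod (gen_g_subproof t).

Definition transversally_independent : Prop :=
  forall (js : 'I_n -> 'I_d) (c : 'I_n -> K),
    \sum_(i < n) c i *: ell i (js i) = 0 -> forall i, c i = 0.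

End Generators.
End Veronese.

(* {alpha in H_n(d) : alpha not >= (i_1,...,i_j,1,...,1)} *)
Definition straightening_ideal n d j (t : Hposet n j) : {set Hposet n d} :=
  [set a | ~~ [forall k : 'I_d, Hentry t k <= Hentry a k]%N].

Lemma le_HposetE n e (s t : Hposet n e) :
  (s <= t)%O = [forall k : 'I_e, Hnth s k <= Hnth t k]%N.
Proof. by rewrite -[LHS]Order.le_val Order.TupleProdOrder.leEtprod. Qed.

Lemma Hposet0 n (s t : Hposet n 0) : s = t.
Proof. by apply: val_inj; rewrite tuple0 [RHS]tuple0. Qed.

Lemma Hposet0_inhabited n : inhabited (Hposet n 0).
Proof. by split; exists (nil_tuple 'I_n); rewrite big_nil. Qed.

Lemma gen_g0 (K : fieldType) n d (ell : 'I_n -> 'I_d -> dhomog n K 1)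
    (j : 'I_d) (t : Hposet n j) :
  j = 0%N :> nat -> val (gen_g ell t) = 1.
Proof. by rewrite /= /ellprod; case: j t => [[|j] hj] t //= _; rewrite big_ord0. Qed.

Lemma straightening_ideal0 n d (t : Hposet n 0) :
  straightening_ideal d t = set0.
Proof.
apply/setP => a; rewrite !inE; apply/negbTE/negPn/forallP => k.
by rewrite /Hentry tuple0 nth_nil.
Qed.

(* Main.v *)
Require Import Defs.
From mathcomp Require Import all_boot all_order all_algebra.

(** Write [f_a] for the generators of the Veronese algebra and [g_t] for those of
    the [j]-th Veronese module, [a] in [H_n(d)] and [t] in [H_n(j)].  Three
    observations give the theorem.

    - Straightening is a swap of factors.  In [f_a * g_t] the first [j] positions
      carry two linear forms each, with indices [a_k] and [t_k].  Giving the
      smaller index to the module generator and the larger one to the algebra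
      element yields [f_a * g_t = b * g_s] with [s = min (a, t)], which is again
      in [H_n(j)] because it lies below [t]; and [s < t] exactly when [a] is in
      the ideal of [t] ([ellprod_straighten]).

    - Independence is inherited from the algebra.  Multiplication by the product
      [u] of the first linear forms in the positions after [j] sends [g_t] to
      [f_(t,1,...,1)], hence a standard element [f_(a1) ... f_(ai) g_t] to
      the standard monomial [f_(t,1,...,1) f_(a1) ... f_(ai)]; the condition
      that [a1] avoids the ideal of [t] says precisely that [(t,1,...,1) <= a1].
      Distinct standard elements go to distinct standard monomials, so they are
      linearly independent ([standard_elt_free]).

    - The [g_t] generate.  They are linearly independent forms of degree [j], and
      their number is the dimension of the space of all such forms, so they span
      it ([ellprod_span]); every monomial of degree [d i + j] is a multiple of one
      of degree [j] ([vermod_generated]).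

    Generation and straightening give spanning by standard elements: a product
    [f_(a1) ... f_(ai) g_t] with [a1] in the ideal of [t] is rewritten over strictly
    smaller generators, and this terminates because the poset is finite
    ([standard_elt_span]). *)

Set Implicit Arguments.
Unset Strict Implicit.
Unset Printing Implicit Defensive.

Import Order.TTheory GRing.Theory.
Local Open Scope ring_scope.

(** * Spans over the ground field, in the form used for bases *)

Section Span.
Variables (K : fieldType) (A : comAlgType K) (M : lmodType A).
Variables (I : eqType) (S : pred I) (b : I -> M).

Definition Kspan (m : M) : Prop :=
  exists (s : seq I) (c : I -> K),
    [/\ uniq s, all S s & m = \sum_(i <- s) (c i)%:A *: b i].

Lemma Kspan0 : Kspan 0.
Proof. by exists [::], (fun=> 0); split; rewrite ?big_nil. Qed.

Lemma Kspan_gen i : S i -> Kspan (b i).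
Proof.
by move=> Si; exists [:: i], (fun=> 1); split; rewrite /= ?Si // big_seq1 !scale1r.
Qed.

Lemma KspanZ k m : Kspan m -> Kspan (k%:A *: m).
Proof.
case=> s [c [us Ss ->]]; exists s, (fun i => k * c i); split=> //.
by rewrite scaler_sumr; apply: eq_bigr => i _; rewrite scalerA mulr_algl scalerA.
Qed.

Lemma KspanD m1 m2 : Kspan m1 -> Kspan m2 -> Kspan (m1 + m2).
Proof.
case=> s1 [c1 [us1 Ss1 ->]] [s2 [c2 [us2 Ss2 ->]]].
(* Both combinations are rewritten over one common duplicate-free list. *)
have widen s c : uniq s -> {subset s <= undup (s1 ++ s2)} ->
    \sum_(i <- s) (c i)%:A *: b i =
    \sum_(i <- undup (s1 ++ s2)) (if i \in s then c i else 0)%:A *: b i.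
  move=> us sub; rewrite [RHS](bigID (mem s)) /= [X in _ + X]big1 ?addr0; last first.
    by move=> i /negbTE->; rewrite !scale0r.
  rewrite -big_filter; rewrite (perm_big [seq i <- undup (s1 ++ s2) | i \in s]) /=.
    by rewrite !big_filter; apply: eq_bigr => i ->.
  apply: uniq_perm; rewrite ?filter_uniq ?undup_uniq //.
  by move=> i; rewrite !mem_filter /=; case si: (i \in s); rewrite ?(sub _ si).
exists (undup (s1 ++ s2)),
  (fun i => (if i \in s1 then c1 i else 0) + (if i \in s2 then c2 i else 0)).
split; first exact: undup_uniq.
  apply/allP => i; rewrite mem_undup mem_cat.
  by case/orP; [move/(allP Ss1) | move/(allP Ss2)].
rewrite (widen s1) // ?(widen s2) // -?big_split /=; last first.
- by move=> i; rewrite mem_undup mem_cat => ->; rewrite ?orbT.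
- by move=> i; rewrite mem_undup mem_cat => ->; rewrite ?orbT.
by apply: eq_bigr => i _; rewrite !scalerDl.
Qed.

Lemma Kspan_sum (J : Type) (s : seq J) (P : pred J) (F : J -> M) :
  (forall i, P i -> Kspan (F i)) -> Kspan (\sum_(i <- s | P i) F i).
Proof. by apply: big_ind => //; [exact: Kspan0 | exact: KspanD]. Qed.

End Span.

(** * Spanning by standard elements *)

Section Straightening.
Variables (K : fieldType) (A : comAlgType K) (M : lmodType A).
Variables (dP : Order.disp_t) (P : finPOrderType dP) (x : P -> A).
Variables (dQ : Order.disp_t) (Q : finPOrderType dQ) (y : Q -> M).
Variable I : Q -> {set P}.

(** Induction on the number of generators below [q].  It suffices to treat
    [monomial w *: y q] with [w] standard; if it is not a standard element, the first
    letter of [w] is in the ideal of [q], and moving it next to [y q] replaces [y q] by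
    smaller generators.  The cofactor may then be an arbitrary algebra element,
    which is why the induction is over all of [A *: y q]. *)
Lemma standard_elt_span :
  (forall a : A, @Kspan K A A^o _ (@standard _ P) (monomial x) a) ->
  (forall q p, p \in I q ->
     exists c : Q -> A, x p *: y q = \sum_(q' : Q | (q' < q)%O) c q' *: y q') ->
  (forall m : M, exists c : Q -> A, m = \sum_q c q *: y q) ->
  forall m : M,
    Kspan (standard_elt I) (fun e : Q * seq P => monomial x e.2 *: y e.1) m.
Proof.
set KS := @Kspan _ _ M _ _ _ => spanA str genM m.
have KSA q a : KS (a *: y q).
  have [r] := ubnP #|[set q' | (q' < q)%O]|.
  elim: r q a => // r IH q a ltr.
  have [s [c [us Ss ->]]] := spanA a.
  rewrite scaler_suml big_seq; apply: Kspan_sum => w ws.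
  rewrite -/(((c w)%:A * monomial x w) *: y q) -scalerA.
  apply: KspanZ; have := allP Ss _ ws.
  case: w {ws} => [|p w] stw.
    exact: (@Kspan_gen _ _ _ _ (standard_elt I) _ (q, [::])).
  have [pI|pI] := boolP (p \in I q); last first.
    by apply: (@Kspan_gen _ _ _ _ (standard_elt I) _ (q, p :: w)); apply/andP.
  have [c' E] := str _ _ pI.
  rewrite /monomial big_cons mulrC -scalerA E scaler_sumr.
  apply: Kspan_sum => q' ltq.
  rewrite scalerA; apply: IH; rewrite -ltnS; apply: leq_trans ltr.
  rewrite ltnS; apply: proper_card; apply/properP; split.
    by apply/subsetP => z; rewrite !inE => /lt_trans; apply.
  by exists q'; rewrite !inE ?ltxx.
have [c ->] := genM m.
by apply: Kspan_sum => q _; exact: KSA.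
Qed.

End Straightening.

(** * The posets of index vectors *)

Lemma sum_succ e (F : 'I_e -> nat) :
  (\sum_(k < e) (F k).+1 = \sum_(k < e) F k + e)%N.
Proof.
under eq_bigr do rewrite -addn1.
by rewrite big_split /= sum1_card card_ord.
Qed.

Section IndexPosets.
Variables (n e : nat).


(** In 0-based entries the defining inequality loses the parameter [e]; with
    [n.-1] it is also correct for [n = 0], where only [e = 0] gives a nonempty
    poset. *)
Lemma Hposet_sum (t : Hposet n e) : (\sum_(k < e) Hnth t k <= n.-1)%N.
Proof.
case: t => t ht; rewrite /Hnth /=.
case: e t ht => [|e'] t; first by rewrite big_ord0.
case: n t => [|m] t; first by case: (tnth t ord0).
by rewrite big_tuple sum_succ addSn subn1 leq_add2r.
Qed.

Lemma Hposet_of_subproof (F : 'I_e -> 'I_n) : (\sum_(k < e) F k <= n.-1)%N ->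
  (\sum_(i <- (mktuple F : e.-tupleprod 'I_n) : seq 'I_n) (i : nat).+1 <= n + e - 1)%N.
Proof.
move=> h; rewrite big_tuple sum_succ (eq_bigr (fun k => F k : nat)) => [|k _]; last first.
  by congr nat_of_ord; exact: tnth_mktuple.
case: e F h => [|e'] F; first by rewrite big_ord0; case: n F.
case: n F => [|m] F; first by case: (F ord0).
by rewrite addSn subn1 leq_add2r.
Qed.

Definition Hposet_of (F : 'I_e -> 'I_n) (h : (\sum_(k < e) F k <= n.-1)%N) : Hposet n e :=
  HPoset (Hposet_of_subproof h).

Lemma Hnth_of F h k : Hnth (@Hposet_of F h) k = F k.
Proof. exact: tnth_mktuple. Qed.

Lemma eq_Hposet (s t : Hposet n e) : Hnth s =1 Hnth t -> s = t.
Proof. by move=> st; apply: val_inj; apply: eq_from_tnth. Qed.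

End IndexPosets.

Lemma Hentry_nth n e (t : Hposet n e) (i0 : 'I_n) (k : nat) : i0 = 0%N :> nat ->
  Hentry t k = (nth i0 (Hval t : seq 'I_n) k).+1.
Proof.
move=> hi0; rewrite /Hentry; congr _.+1.
have [lk|gk] := ltnP k e.
  by rewrite (nth_map i0) // size_tuple.
by rewrite !nth_default ?size_map ?size_tuple.
Qed.

Lemma Hentry_Hnth n e (t : Hposet n e) (k : 'I_e) : Hentry t k = (Hnth t k).+1.
Proof.
rewrite /Hentry (nth_map (Hnth t k)) ?size_tuple //.
by rewrite /Hnth [in RHS](tnth_nth (Hnth t k)).
Qed.

Lemma Hentry_default n e (t : Hposet n e) (k : nat) : (e <= k)%N -> Hentry t k = 1%N.
Proof. by move=> ek; rewrite /Hentry nth_default // size_map size_tuple. Qed.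

Lemma nth_Hnth n e (t : Hposet n e) (i0 : 'I_n) (k : 'I_e) :
  nth i0 (Hval t : seq 'I_n) k = Hnth t k.
Proof. by rewrite /Hnth (tnth_nth i0). Qed.

Lemma card_Hposet n e : #|{: Hposet n.+1 e}| = 'C(e + n, e).
Proof.
rewrite -card_partial_ord_partitions cardsE card_sub.
apply: eq_card => t; rewrite [LHS]unfold_in [RHS]unfold_in /= !big_tuple sum_succ.
by rewrite addSn subn1 leq_add2r.
Qed.

(** Extension of an index vector by ones, [(t_1, ..., t_e, 1, ..., 1)]; in 0-based
    entries this pads with [i0 = 0]. *)
Section Extension.
Variables (n d e : nat) (he : (e <= d)%N) (i0 : 'I_n) (hi0 : i0 = 0%N :> nat).

Lemma ext_subproof (t : Hposet n e) :
  (\sum_(k < d) nth i0 (Hval t : seq 'I_n) k <= n.-1)%N.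
Proof.
rewrite (bigID (fun k : 'I_d => (k < e)%N)) /= [X in (_ + X)%N]big1; last first.
  by move=> k; rewrite -leqNgt => ek; rewrite nth_default ?size_tuple.
rewrite addn0 big_ord_narrow (eq_bigr (fun k => Hnth t k : nat)); first exact: Hposet_sum.
by move=> k _; rewrite nth_Hnth.
Qed.

Definition Hext (t : Hposet n e) : Hposet n d := Hposet_of (ext_subproof t).

Lemma Hentry_ext t (k : 'I_d) : Hentry (Hext t) k = Hentry t k.
Proof. by rewrite Hentry_Hnth Hnth_of (Hentry_nth _ _ hi0). Qed.

Lemma Hext_inj : injective Hext.
Proof.
move=> s t est; apply: eq_Hposet => k; apply/val_inj/succn_inj.
have : Hentry (Hext s) (widen_ord he k) = Hentry (Hext t) (widen_ord he k).
  by rewrite est.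
by rewrite !Hentry_ext /= !Hentry_Hnth.
Qed.

(** The ideal attached to [t] is the complement of an upper cone: this turns the side
    condition on standard elements into standardness of a monomial. *)
Lemma Hext_le t a : (Hext t <= a)%O = (a \notin straightening_ideal d t).
Proof.
rewrite le_HposetE inE negbK; apply: eq_forallb => k.
by rewrite -Hentry_ext !Hentry_Hnth.
Qed.

End Extension.

Lemma Hposet_ord0 n e (t : Hposet n e) : (0 < e)%N -> exists i0 : 'I_n, i0 = 0%N :> nat.
Proof.
case: n e t => [|n] [|e] t // _; last by exists ord0.
by case: (Hnth t ord0).
Qed.

(** * Products of the linear forms *)

Section Products.
Variables (K : fieldType) (n d : nat) (ell : 'I_n -> 'I_d -> dhomog n K 1).

Lemma gen_fE t : val (gen_f ell t) = \prod_(k < d) (ell (Hnth t k) k : {mpoly K[n]}).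
Proof. by apply: eq_bigr => k _; congr (mpoly_of_dhomog (ell _ _)); apply: val_inj. Qed.

Lemma prod_ell_veralg (F : 'I_d -> 'I_n) :
  \prod_(k < d) (ell (F k) k : {mpoly K[n]}) \in @veralg_pred K n d.
Proof.
have hom : \prod_(k < d) (ell (F k) k : {mpoly K[n]}) \is d.-homog.
  have dE : (\sum_(k < d) 1 = d)%N by rewrite sum1_card card_ord.
  rewrite -[X in X.-homog]dE.
  elim/big_rec2: _ => [|k m p _ hp]; first exact: dhomog1.
  by apply: dhomogM => //; apply: dhomog_is_dhomog.
by apply/allP => m /(dhomog_mf hom) /= ->; rewrite subn0 dvdnn.
Qed.

Variables (e : nat) (he : (e <= d)%N).

Lemma prod_split (F : 'I_d -> {mpoly K[n]}) :
  \prod_(k < d) F k =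
  (\prod_(k < e) F (widen_ord he k)) * \prod_(k < d | (e <= k)%N) F k.
Proof.
rewrite (bigID (fun k : 'I_d => (k < e)%N)) /= big_ord_narrow; congr (_ * _).
by apply: eq_bigl => k; rewrite -leqNgt.
Qed.

Lemma gen_f_ext (i0 : 'I_n) (hi0 : i0 = 0%N :> nat) t :
  val (gen_f ell (Hext he hi0 t)) =
  ellprod ell he t * \prod_(k < d | (e <= k)%N) (ell i0 k : {mpoly K[n]}).
Proof.
rewrite gen_fE prod_split; congr (_ * _).
  by apply: eq_bigr => k _; rewrite Hnth_of nth_Hnth.
by apply: eq_bigr => k ek; rewrite Hnth_of nth_default ?size_tuple.
Qed.

(** In every position before [e], the smaller of the two indices [a_k], [t_k] goes to
    the module generator and the larger one to the cofactor. *)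
Lemma ellprod_straighten (t : Hposet n e) (a : Hposet n d) :
  a \in straightening_ideal d t ->
  exists (b : veralg K n d) (s : Hposet n e), (s < t)%O /\
    val (gen_f ell a) * ellprod ell he t = val b * ellprod ell he s.
Proof.
rewrite inE => /forallPn[k0]; rewrite -ltnNge => k0P.
(* Beyond position [e] the entries of [t] are 1, hence never too large. *)
have k0e : (k0 < e)%N.
  by rewrite ltnNge; apply/negP => /(Hentry_default t) E; rewrite E Hentry_Hnth in k0P.
pose w := widen_ord he.
pose F k := if (Hnth t k <= Hnth a (w k))%N then Hnth t k else Hnth a (w k).
have Ft k : (F k <= Hnth t k)%N.
  by rewrite /F; case: (leqP (Hnth t k) (Hnth a _)) => // /ltnW.
have Fa k : (F k <= Hnth a (w k))%N.
  by rewrite /F; case: (leqP (Hnth t k) (Hnth a _)).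
have hF : (\sum_(k < e) F k <= n.-1)%N.
  by apply: leq_trans (Hposet_sum t); apply: leq_sum => k _.
(* The default value makes [G] agree with [a] in the positions from [e] on. *)
pose G (k : 'I_d) := let m := nth (Hnth a k) (Hval t : seq 'I_n) k in
  if (m <= Hnth a k)%N then Hnth a k else m.
exists (VerAlg (prod_ell_veralg G)), (Hposet_of hF); split.
  rewrite lt_neqAle; apply/andP; split; last first.
    by rewrite le_HposetE; apply/forallP => k; rewrite Hnth_of.
  apply/eqP => E; have := Fa (Ordinal k0e).
  have -> : w (Ordinal k0e) = k0 by apply: val_inj.
  move: k0P; rewrite Hentry_Hnth -[val k0]/(val (Ordinal k0e)) Hentry_Hnth ltnS.
  by rewrite -(Hnth_of hF) E => /leq_trans/[apply]; rewrite ltnn.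
rewrite gen_fE /= !prod_split mulrAC [RHS]mulrAC; congr (_ * _); last first.
  by apply: eq_bigr => k ek; rewrite /G nth_default ?size_tuple // leqnn.
rewrite -!big_split /=; apply: eq_bigr => k _.
rewrite Hnth_of /F /G nth_Hnth; case: ifP => _ //.
by rewrite mulrC.
Qed.

End Products.

(** * Independence of the standard elements *)

Section ASLbasis.
Variables (K : fieldType) (n d : nat) (ell : 'I_n -> 'I_d -> dhomog n K 1).
Hypothesis hASL : ASL (@veralg_grade K n d) (gen_f ell).

(** Multiplication by a fixed polynomial [u] transports linear relations from the
    module to the algebra, where standard monomials are independent. *)
Lemma free_of_monomials (I : eqType) (S : pred I) (j : nat) (b : I -> vermod K n d j)
    (phi : I -> seq (Hposet n d)) (u : {mpoly K[n]}) :
  injective phi -> (forall i, S i -> standard (phi i)) ->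
  (forall i, val (monomial (gen_f ell) (phi i)) = u * val (b i)) ->
  forall (s : seq I) (c : I -> K), uniq s -> all S s ->
    \sum_(i <- s) (c i)%:A *: b i = 0 -> forall i, i \in s -> c i = 0.
Proof.
move=> phiI phiS phiE s c us Ss sum0 i si.
have [fr _] := ASL1 hASL.
(* [c] read on monomials, through the inverse of [phi] on [s]. *)
pose c' w := c (nth i s (index w (map phi s))).
have c'E k : k \in s -> c' (phi k) = c k.
  by move=> sk; rewrite /c' index_map // nth_index.
rewrite -c'E //; apply: (fr (map phi s) c').
- by rewrite map_inj_uniq.
- by apply/allP => _ /mapP[k sk ->]; apply: phiS; apply: (allP Ss).
- rewrite big_map; apply: val_inj; rewrite raddf_sum raddf0 /=.
  rewrite -[RHS](mulr0 u) -[X in u * X]/(val (0 : vermod K n d j)) -sum0.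
  rewrite raddf_sum mulr_sumr big_seq [RHS]big_seq; apply: eq_bigr => k sk.
  rewrite c'E // /= -!mul_mpolyC.
  by rewrite phiE; rewrite !mulr1 mulrCA.
- exact: map_f.
Qed.

Variable j : 'I_d.
Let hj : (j <= d)%N := ltnW (ltn_ord j).

(** For [j > 0] the multiplier is [u = ell_(1,j+1) ... ell_(1,d)].  It does not make sense
    when there are no variables, but then a generator exists only for [j = 0],
    and in that case the standard elements already are the standard monomials. *)
Lemma standard_elt_free
  (s : seq (Hposet n j * seq (Hposet n d))) (c : Hposet n j * seq (Hposet n d) -> K) :
  uniq s -> all (standard_elt (fun t : Hposet n j => straightening_ideal d t)) s ->
  \sum_(i <- s) (c i)%:A *: (monomial (gen_f ell) i.2 *: gen_g ell i.1) = 0 ->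
  forall i, i \in s -> c i = 0.
Proof.
have [j0|j_gt0] := posnP j.
  apply: (free_of_monomials (phi := snd) (u := 1)).
  - move=> [t1 w1] [t2 w2] /= ->; congr (_, _); apply: eq_Hposet => k.
    by have := ltn_ord k; rewrite [X in (_ < X)%N]j0.
  - by case=> t w /andP[].
  - by move=> [t w]; rewrite /= mul1r -[ellprod _ _ _]/(val (gen_g ell t)) gen_g0 // mulr1.
case: s => // -[t0 w0] s; have [i0 hi0] := Hposet_ord0 t0 j_gt0.
apply: (free_of_monomials (phi := fun e => Hext hj hi0 e.1 :: e.2)
   (u := \prod_(k < d | (j <= k)%N) (ell i0 k : {mpoly K[n]}))).
- move=> [t1 w1] [t2 w2] /= /eqP; rewrite eqseq_cons.
  by case/andP=> /eqP/Hext_inj-> /eqP->.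
- case=> t [|p w] //= /andP[st pI].
  by rewrite /standard /= Hext_le pI.
- move=> [t w]; rewrite /monomial big_cons /= -[ellprod _ (leqnn d) _]/(val (gen_f ell (Hext hj hi0 t))).
  by rewrite gen_f_ext -mulrA mulrC -mulrA.
Qed.

Lemma ellprod_free (c : Hposet n j -> K) :
  \sum_t c t *: ellprod ell hj t = 0 -> forall t, c t = 0.
Proof.
move=> sum0 t.
apply: (@standard_elt_free [seq (t, [::]) | t <- enum {: Hposet n j}]
   (fun e => c e.1) _ _ _ (t, [::])).
- by rewrite map_inj_uniq ?enum_uniq // => x y [].
- by apply/allP => _ /mapP[x _ ->].
- apply: val_inj; rewrite big_map big_enum raddf_sum raddf0 -[RHS]sum0 /=.
  by apply: eq_bigr => x _; rewrite /monomial big_nil mul1r -!mul_mpolyC mulr1.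
- by rewrite map_f ?mem_enum.
Qed.

Lemma gen_g_inj : injective (gen_g ell (j := j)).
Proof.
move=> t1 t2 /(congr1 val) /= E; apply/eqP/negP => /negP t12.
have delta t : \sum_t' (t' == t)%:R *: ellprod ell hj t' = ellprod ell hj t.
  rewrite (bigD1 t) //= eqxx scale1r big1 ?addr0 // => t' /negbTE->.
  by rewrite scale0r.
have := @ellprod_free (fun t => (t == t1)%:R - (t == t2)%:R) _ t1.
rewrite eqxx (negbTE t12) subr0 => h; suff /eqP : (1 : K) = 0 by rewrite oner_eq0.
apply: h; under eq_bigr do rewrite scalerBl.
by rewrite sumrB !delta E subrr.
Qed.

End ASLbasis.

(** * Generation of the Veronese module *)

Lemma dhomog_free_span (K : fieldType) n e (T : finType) (g : T -> dhomog n.+1 K e) :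
  #|T| = 'C(e + n, e) ->
  (forall c : T -> K, \sum_t c t *: g t = 0 -> forall t, c t = 0) ->
  forall p : dhomog n.+1 K e, exists c : T -> K, p = \sum_t c t *: g t.
Proof.
move=> cardT fr p; pose X := [tuple g (enum_val i) | i < #|T|].
have XE (i : 'I_#|T|) : X`_i = g (enum_val i) by rewrite -tnth_nth tnth_mktuple.
have reind (c : 'I_#|T| -> K) :
    \sum_i c i *: X`_i = \sum_t c (enum_rank t) *: g t.
  rewrite (reindex (@enum_val T T)) /=; last first.
    by exists enum_rank => t _; rewrite ?enum_valK ?enum_rankK.
  by apply: eq_bigr => i _; rewrite XE enum_valK.
have freeX : free X.
  apply/freeP => k; rewrite reind => /fr h i.
  by rewrite -[i]enum_valK h.
have bX : basis_of fullv X.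
  rewrite basisEfree freeX subvf dimvf size_tuple cardT.
  exact: leqnn.
exists (fun t => coord X (enum_rank t) p).
by rewrite -(reind (fun i => coord X i p)); exact: coord_basis bX (memvf p).
Qed.

Lemma mpoly0_homogE (K : fieldType) e (p : {mpoly K[0]}) :
  p \is e.-homog -> p = (if e == 0%N then p@_0 else 0)%:MP.
Proof.
move=> hp; apply/mpolyP => m; rewrite mcoeffC.
have -> : m = 0%MM by apply/mnmP; case.
rewrite eqxx mulr1; case: eqP => // /eqP e0.
by apply: (dhomog_nemf_coeff hp); rewrite mf0 eq_sym.
Qed.

(** The index vectors in [H_n(e)] are equinumerous with the monomials of degree [e] in [n]
    variables, so independence forces spanning.  Without variables every polynomial is constant
    and the count degenerates, so [n = 0] is checked directly. *)
Lemma ellprod_span (K : fieldType) n d (ell : 'I_n -> 'I_d -> dhomog n K 1) e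
    (he : (e <= d)%N) :
  (forall c : Hposet n e -> K,
     \sum_t c t *: ellprod ell he t = 0 -> forall t, c t = 0) ->
  forall p : {mpoly K[n]}, p \is e.-homog ->
  exists c : Hposet n e -> K, p = \sum_t c t *: ellprod ell he t.
Proof.
case: n ell => [|n] ell fr p hp.
  rewrite (mpoly0_homogE hp); case: eqP => [e0|_]; last first.
    by exists (fun=> 0); rewrite mpolyC0 big1 // => t _; rewrite scale0r.
  subst e; case: (Hposet0_inhabited 0) => t0.
  exists (fun=> p@_0); rewrite (big_pred1 t0) => [|t]; last first.
    by rewrite /= (Hposet0 t t0) eqxx.
  by rewrite /ellprod big_ord0 -mul_mpolyC mulr1.
pose g t := DHomog (ellprod_homog ell he t).
have valg (c : Hposet n.+1 e -> K) :
    \sum_t c t *: ellprod ell he t = val (\sum_t c t *: g t).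
  by rewrite raddf_sum.
have [|c E] := @dhomog_free_span K n e _ g (card_Hposet n e) _ (DHomog hp).
  by move=> c /(congr1 val); rewrite -valg => /fr.
by exists c; rewrite valg -E.
Qed.

Lemma mnm_factor n (m : 'X_{1..n}) e : (e <= mdeg m)%N ->
  exists m1 m2 : 'X_{1..n}, m = (m1 + m2)%MM /\ mdeg m2 = e.
Proof.
elim: e => [|e IH] he; first by exists m, 0%MM; rewrite addm0 mdeg0.
have [m1 [m2 [E d2]]] := IH (ltnW he).
have : m1 != 0%MM.
  by apply: contraTneq he => m10; rewrite E m10 add0m d2 ltnn.
rewrite -mdeg_eq0 mdegE -lt0n lt0n sum_nat_eq0 => /forallPn[i]; rewrite /= => mi.
exists (m1 - U_(i))%MM, (m2 + U_(i))%MM; split; last by rewrite mdegD mdeg1 d2 addn1.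
by rewrite E (addmC m2) addmA submK // lep1mP.
Qed.

Lemma vermod_generated (K : fieldType) n d (ell : 'I_n -> 'I_d -> dhomog n K 1)
    (j : 'I_d) :
  (forall p : {mpoly K[n]}, p \is j.-homog -> exists c : Hposet n j -> K,
     p = \sum_t c t *: ellprod ell (ltnW (ltn_ord j)) t) ->
  forall m : vermod K n d j, exists c : Hposet n j -> veralg K n d,
    m = \sum_t c t *: gen_g ell t.
Proof.
move=> span [p hp]; have /allP supp := hp.
suff [c E] : exists c : Hposet n j -> veralg K n d,
    p = \sum_t val (c t) * ellprod ell (ltnW (ltn_ord j)) t.
  by exists c; apply: val_inj; rewrite raddf_sum.
rewrite (mpolyE p) big_seq; apply: (big_ind (fun q => exists c : Hposet n j -> veralg K n d,
    q = \sum_t val (c t) * ellprod ell (ltnW (ltn_ord j)) t)).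
- by exists (fun=> 0); rewrite big1 // => t _; rewrite mul0r.
- move=> _ _ [c1 ->] [c2 ->]; exists (fun t => c1 t + c2 t).
  by rewrite -big_split; apply: eq_bigr => t _; rewrite /= -mulrDl.
move=> m /supp /= /andP[jm dm].
have [m1 [m2 [mE d2]]] := mnm_factor jm.
move: dm; rewrite mE mdegD d2 addnK => dm1 {m jm mE}.
have [|c E] := span 'X_[m2]; first by rewrite dhomogX; apply/eqP.
have h t : (p@_(m1 + m2) * c t) *: 'X_[m1] \in @veralg_pred K n d.
  apply/allP => m' /msuppZ_le; rewrite msuppX inE => /eqP->.
  by rewrite subn0.
exists (fun t => VerAlg (h t)); rewrite mpolyXD E mulr_sumr scaler_sumr.
by apply: eq_bigr => t _; rewrite /= -scalerAr -scalerAl scalerA.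
Qed.

(** * The grading, and the theorem *)

Section Grading.
Variables (K : fieldType) (n d : nat) (d_gt0 : (0 < d)%N).

Lemma vermod_direct_sum j : direct_sum (@vermod_grade K n d j).
Proof.
split.
- move=> i; split; first exact: dhomog0.
  by move=> u v hu hv; rewrite /vermod_grade raddfB /= rpredB.
- move=> [p hp]; have /allP supp := hp.
  have h i : pihomog mdeg (d * i + j) p \in @veronese_pred K n d j.
    apply/allP => m /(dhomog_mf (pihomogP _ _ _)) /= ->.
    by rewrite leq_addl addnK dvdn_mulr.
  (* Since [d > 0], the component index does not exceed the degree it stands for,
     so [msize p] components suffice. *)
  exists (msize p), (fun i => VerMod (h i)); split=> [i|]; first exact: pihomogP.
  apply: val_inj; rewrite raddf_sum /= {1}(mpolyE p).
  under [RHS]eq_bigr do rewrite pihomogE big_mkcond.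
  rewrite exchange_big /= [LHS]big_seq [RHS]big_seq; apply: eq_bigr => m pm.
  have /andP[jm /dvdnP[i Ei]] := supp _ pm.
  have mE : mdeg m = (d * i + j)%N by rewrite mulnC -Ei subnK.
  have ilt : (i < msize p)%N.
    apply: leq_ltn_trans (msize_mdeg_lt pm).
    by rewrite mE (leq_trans (leq_pmull i d_gt0)) // leq_addr.
  rewrite (bigD1 (Ordinal ilt)) //= mE eqxx big1 ?addr0 // => k kN.
  case: eqP => // /addIn /eqP; rewrite eqn_pmul2l // => /eqP ki.
  by case/eqP: kN; apply: val_inj.
- move=> N c hc sum0 i iN; apply: val_inj.
  have := congr1 (fun v => pihomog mdeg (d * i + j) (val v)) sum0.
  rewrite (raddf_sum val) linear_sum !raddf0 (bigD1 (Ordinal iN)) //= big1 ?addr0.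
    by rewrite pihomog_dE //; apply: hc.
  move=> k ki; apply: (@pihomog_ne0 _ _ _ (d * k + j)); last exact: hc.
  by rewrite eqn_add2r eqn_pmul2l.
Qed.

Lemma vermod_graded j :
  graded_module (@veralg_grade K n d) (@vermod_grade K n d j).
Proof.
split; first exact: vermod_direct_sum.
move=> i k a m ha hm; rewrite /vermod_grade mulnDr -addnA.
exact: dhomogM.
Qed.

End Grading.

Theorem theorem2p1 (K : fieldType)
    (K_infinite : ~ (exists s : seq K, forall x : K, x \in s))
    (n d : nat) (d_ge2 : (2 <= d)%N)
    (ell : 'I_n -> 'I_d -> dhomog n K 1)
    (ell_indep : transversally_independent ell)
    (ell_ASL : homogeneous_ASL (@veralg_grade K n d) (gen_f ell))
    (j : 'I_d) :
  homogeneous_MSL (@veralg_grade K n d) (gen_f ell)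
    (@vermod_grade K n d j) (@gen_g K n d ell j)
    (fun t : Hposet n j => straightening_ideal d t).
Proof.
have asl := hASL_ASL ell_ASL.
have str (q : Hposet n j) (p : Hposet n d) : p \in straightening_ideal d q ->
    exists c : Hposet n j -> veralg K n d,
      gen_f ell p *: gen_g ell q =
      \sum_(q' : Hposet n j | (q' < q)%O) c q' *: gen_g ell q'.
  move=> /(ellprod_straighten ell (ltnW (ltn_ord j)))[b [s [sq E]]].
  exists (fun q' => if q' == s then b else 0).
  rewrite (bigD1 s) //= eqxx big1 ?addr0; first exact: val_inj.
  by move=> q' /andP[_ /negbTE->]; rewrite scale0r.
split => //.
- split=> //.
  + exact: gen_g_inj.
  + move=> q a b; rewrite !inE => /forallPn[k kq] ba.
    apply/forallPn; exists k; apply: contra kq => /leq_trans; apply.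
    move: ba; rewrite le_HposetE => /forallP/(_ k).
    by rewrite !Hentry_Hnth.
  + split; first exact: standard_elt_free.
    apply: standard_elt_span => //.
      by move=> a; case: (ASL1 asl) => _; apply.
    by apply: vermod_generated; apply: ellprod_span; apply: ellprod_free.
- by apply: vermod_graded; apply: ltnW.
- by move=> q; rewrite /vermod_grade muln0; apply: ellprod_homog.
Qed.
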